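(* For any ring $R$ (unital or nonunital) we have $\Lambda(R) \cong \Lambda^1(R^1)$ as graphs, where the isomorphism $\hat{\imath} \colon \Lambda(R) \to \Lambda^1(R^1)$ is given by $\hat{\imath}([a]) = [i(a)]_1$.
   Context: Rings are associative. For a ring $R$ (possibly nonunital) and $a\in R$, let $\langle a \rangle = \{q(a) \mid q \in \mathbb{Z}[x],\ q(0)=0\}$ be the subring generated by $a$; write $a \sim b$ iff $\langle a\rangle=\langle b\rangle$, with equivalence class $[a]$. The compressed commuting graph $\Lambda(R)$ is the undirected graph (with loops) whose vertices are the classes $[a]$, $a \in R$, with an edge between $[a]$ and $[b]$ iff $ab=ba$. For a unital ring $R$, let $\langle a\rangle_1=\{q(a)\mid q\in\mathbb{Z}[x]\}$ be the subring generated by $1$ and $a$; write $a\sim_1 b$ iff $\langle a\rangle_1=\langle b\rangle_1$, with equivalence class $[a]_1$. The unital compressed commuting graph $\Lambda^1(R)$ is the undirected graph (with loops) whose vertices are the classes $[a]_1$, $a\in R$, with an edge between $[a]_1$ and $[b]_1$ iff $ab=ba$. The zero ring is regarded as unital with $1=0$. The characteristic of a ring $R$ is the least positive integer $m$ with $mR=0$ if such $m$ exists, and $m=0$ otherwise; $\mathbb{Z}_m=\mathbb{Z}/m\mathbb{Z}$, with $\mathbb{Z}_0=\mathbb{Z}$. Then $R$ is a $\mathbb{Z}_m$-module, and $R^1$ denotes the set $\mathbb{Z}_m \times R$ with componentwise addition and multiplication $(k,a)(n,b)=(kn,\,na+kb+ab)$; it is a unital ring with identity $(1,0)$. The canonical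 embedding $i\colon R\to R^1$ is $i(r)=(0,r)$. *)

(* Defs.v *)
From HB Require Import structures.
From mathcomp Require Import all_boot all_order all_algebra.
From mathcomp Require Import generic_quotient ring_quotient.
From mathcomp Require Import boolp classical_sets.

Set Implicit Arguments.
Unset Strict Implicit.
Unset Printing Implicit Defensive.

Import GRing.Theory.
Local Open Scope ring_scope.
Local Open Scope classical_set_scope.
Local Open Scope quotient_scope.

(** * Associative rings, possibly without identity *)

HB.mixin Record Zmodule_isRng R of GRing.Zmodule R := {
  rngmul : R -> R -> R;
  rngmulA : associative rngmul;
  rngmulDl : left_distributive rngmul +%R;
  rngmulDr : right_distributive rngmul +%R;
}.

#[short(type="rngType")]
HB.structure Definition Rng := { R of Zmodule_isRng R & GRing.Zmodule R }.

Bind Scope ring_scope with Rng.sort.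

Notation "x ** y" := (rngmul x y) (at level 40, left associativity) : ring_scope.

Section RngTheory.
Variable R : rngType.
Implicit Types (a b c : R) (k : int).

Lemma rngmul0r a : 0 ** a = 0.
Proof. by apply: (addIr (0 ** a)); rewrite -rngmulDl !add0r. Qed.

Lemma rngmulr0 a : a ** 0 = 0.
Proof. by apply: (addIr (a ** 0)); rewrite -rngmulDr !add0r. Qed.

Lemma rngmul_subproof_l b : zmod_morphism (fun a => a ** b).
Proof.
move=> x y; apply: (addIr (y ** b)).
by rewrite -rngmulDl !subrK.
Qed.

Lemma rngmul_subproof_r a : zmod_morphism (rngmul a).
Proof.
move=> x y; apply: (addIr (a ** y)).
by rewrite -rngmulDr !subrK.
Qed.

HB.instance Definition _ a :=
  GRing.isZmodMorphism.Build R R (rngmul a) (rngmul_subproof_r a).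

Lemma rngmulrz a b k : a ** (b *~ k) = (a ** b) *~ k.
Proof. exact: raddfMz. Qed.

Lemma rngmulzl a b k : (a *~ k) ** b = (a ** b) *~ k.
Proof.
pose f := GRing.isZmodMorphism.Build R R _ (rngmul_subproof_l b).
pose g : {additive R -> R} := HB.pack (fun a => a ** b) f.
exact: (raddfMz g).
Qed.

(** The power [a ^ n] for [0 < n]; the value at [n = 0] is junk, and not used. *)
Definition rngexp a (n : nat) : R := iter n.-1 (rngmul a) a.

(** The value [q(a)] of an integer polynomial [q] with [q(0) = 0]. *)
Definition rngeval (q : {poly int}) a : R :=
  \sum_(1 <= i < size q) rngexp a i *~ q`_i.

(** The subring [<a>] generated by [a]. *)
Definition rnggen a : set R :=
  [set rngeval q a | q in [set q : {poly int} | q.[0] = 0]].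

Lemma rngeval_comm q a b : a ** b = b ** a -> rngeval q a ** b = b ** rngeval q a.
Proof.
move=> ab; rewrite /rngeval raddf_sum /=.
elim/big_ind2: _ => [|x x' y y' ex ey|i _].
- by rewrite rngmul0r.
- by rewrite rngmulDl ex ey.
rewrite rngmulzl rngmulrz; congr (_ *~ _).
rewrite /rngexp; elim: i.-1 => //= n IHn.
by rewrite -rngmulA IHn !rngmulA ab.
Qed.

Lemma mem_rnggen a : rnggen a a.
Proof.
exists 'X; first by rewrite /= hornerX.
by rewrite /rngeval size_polyX big_nat1 coefX.
Qed.

Lemma rnggen_comm a a' b b' : rnggen a = rnggen a' -> rnggen b = rnggen b' ->
  a ** b = b ** a -> a' ** b' = b' ** a'.
Proof.
move=> ea eb ab.
have := mem_rnggen a'; rewrite -ea => -[q _ <-].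
have := mem_rnggen b'; rewrite -eb => -[r _ <-].
by apply: rngeval_comm; apply/esym/rngeval_comm/esym.
Qed.

Definition annihilates (m : nat) : Prop := forall a, a *+ m = 0.

(** The characteristic: [0] when no positive integer annihilates [R]. *)
Definition rngchar : nat :=
  if pselect (exists m, (0 < m)%N && `[< annihilates m >]) is left ex_m
  then ex_minn ex_m else 0.

Lemma mulrn_rngchar a : a *+ rngchar = 0.
Proof.
rewrite /rngchar; case: pselect => [ex_m|_]; last by rewrite mulr0n.
by case: ex_minnP => m /andP[_ /asboolP].
Qed.

End RngTheory.

(** * The ring [Z / mZ]: [Zmod 0] is [Z], and [Zmod 1] is the zero ring *)

Section Zmod.
Variable m : nat.

(** The ideal [m Z]. *)
Definition multiples : zmodClosed int :=
  Eval hnf in GRing.ZmodClosed.clone int (dvdz m) _.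

Definition Zmod : Type := {ideal_quot multiples}.

HB.instance Definition _ := GRing.Zmodule.on Zmod.

Lemma eq_Zmod (k l : int) : (k == l %[mod Zmod]) = (m %| k - l)%Z.
Proof. by rewrite piE. Qed.

Definition Zmod_one : Zmod := \pi_Zmod 1.
Definition Zmod_mul : Zmod -> Zmod -> Zmod := lift_op2 Zmod *%R.

Lemma pi_Zmod_add k l : \pi_Zmod (k + l) = \pi_Zmod k + \pi_Zmod l.
Proof. exact: pi_addr. Qed.

Lemma pi_Zmod_mul k l : \pi_Zmod (k * l) = Zmod_mul (\pi_Zmod k) (\pi_Zmod l).
Proof.
rewrite /Zmod_mul; unlock; apply/eqP; rewrite eq_Zmod.
set k' := repr _; set l' := repr _.
have dk : (m %| k - k')%Z by rewrite -eq_Zmod reprK.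
have dl : (m %| l - l')%Z by rewrite -eq_Zmod reprK.
rewrite -(subrK (k' * l) (k * l)) -mulrBl -addrA -mulrBr.
by apply: rpredD; [apply: dvdz_mulr|apply: dvdz_mull].
Qed.

Lemma Zmod_mulA : associative Zmod_mul.
Proof.
by elim/quotW=> k; elim/quotW=> l; elim/quotW=> n; rewrite -!pi_Zmod_mul mulrA.
Qed.

Lemma Zmod_mulC : commutative Zmod_mul.
Proof. by elim/quotW=> k; elim/quotW=> l; rewrite -!pi_Zmod_mul mulrC. Qed.

Lemma Zmod_mul1 : left_id Zmod_one Zmod_mul.
Proof. by elim/quotW=> k; rewrite -pi_Zmod_mul mul1r. Qed.

Lemma Zmod_mulDl : left_distributive Zmod_mul +%R.
Proof.
elim/quotW=> k; elim/quotW=> l; elim/quotW=> n.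
by rewrite -pi_Zmod_add -!pi_Zmod_mul mulrDl pi_Zmod_add.
Qed.

HB.instance Definition _ := GRing.Zmodule_isComPzRing.Build Zmod
  Zmod_mulA Zmod_mulC Zmod_mul1 Zmod_mulDl.

End Zmod.

(** * The unitization [R^1] *)

Section Unitization.
Variable R : rngType.
Local Notation Zm := (Zmod (rngchar R)).
Implicit Types (a b : R) (x y : Zm).

(** The action of [Z / mZ] on [R], where [m] is the characteristic of [R];
    [Zmod_actE] shows that it does not depend on the representative. *)
Definition Zmod_act x a : R := a *~ repr x.

Lemma Zmod_actE (k : int) a : Zmod_act (\pi_Zm k) a = a *~ k.
Proof.
have /dvdzP[q eq_q] : (rngchar R %| repr (\pi_Zm k) - k)%Z.
  by rewrite -eq_Zmod reprK.
apply/eqP; rewrite -subr_eq0 -mulrzBr eq_q mulrC mulrzA.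
by rewrite -pmulrn mulrn_rngchar mul0rz.
Qed.

Lemma Zmod_actDr x a b : Zmod_act x (a + b) = Zmod_act x a + Zmod_act x b.
Proof. exact: mulrzDl. Qed.

Lemma Zmod_actDl x y a : Zmod_act (x + y) a = Zmod_act x a + Zmod_act y a.
Proof.
elim/quotW: x => k; elim/quotW: y => l.
by rewrite -pi_Zmod_add !Zmod_actE mulrzDr.
Qed.

Lemma Zmod_actA x y a : Zmod_act (x * y) a = Zmod_act x (Zmod_act y a).
Proof.
elim/quotW: x => k; elim/quotW: y => l.
rewrite -[_ * _]pi_Zmod_mul !Zmod_actE.
by rewrite mulrC mulrzA.
Qed.

Lemma Zmod_act1 a : Zmod_act 1 a = a.
Proof. by rewrite -[1]/(\pi_Zm 1) Zmod_actE. Qed.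

Lemma Zmod_actMl x a b : Zmod_act x a ** b = Zmod_act x (a ** b).
Proof. exact: rngmulzl. Qed.

Lemma Zmod_actMr x a b : a ** Zmod_act x b = Zmod_act x (a ** b).
Proof. exact: rngmulrz. Qed.

Definition unitization : Type := (Zm * R)%type.

HB.instance Definition _ := GRing.Zmodule.on unitization.

Implicit Types u v w : unitization.

Definition unitization_one : unitization := (1, 0).

Definition unitization_mul u v : unitization :=
  (u.1 * v.1, Zmod_act v.1 u.2 + Zmod_act u.1 v.2 + u.2 ** v.2).

Lemma unitization_mulA : associative unitization_mul.
Proof.
case=> [k a] [l b] [n c]; rewrite /unitization_mul /=; congr pair.
  exact: mulrA.
rewrite !(Zmod_actDr, rngmulDl, rngmulDr) !(Zmod_actMl, Zmod_actMr).
rewrite -!Zmod_actA rngmulA (mulrC n k) (mulrC n l).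
rewrite -!addrA; congr (_ + _); congr (_ + _).
rewrite [RHS]addrCA; congr (_ + _).
by rewrite addrCA; congr (_ + _); rewrite addrCA.
Qed.

Lemma unitization_mul1u : left_id unitization_one unitization_mul.
Proof.
case=> k a; rewrite /unitization_mul /= mul1r Zmod_act1 rngmul0r.
by rewrite /Zmod_act mul0rz add0r addr0.
Qed.

Lemma unitization_mulu1 : right_id unitization_one unitization_mul.
Proof.
case=> k a; rewrite /unitization_mul /= mulr1 Zmod_act1 rngmulr0.
by rewrite /Zmod_act mul0rz !addr0.
Qed.

Lemma unitization_mulDl : left_distributive unitization_mul +%R.
Proof.
case=> [k a] [l b] [n c]; rewrite /unitization_mul /=; congr pair.
  exact: mulrDl.
rewrite /= Zmod_actDr Zmod_actDl rngmulDl [X in X + _]addrACA.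
exact: addrACA.
Qed.

Lemma unitization_mulDr : right_distributive unitization_mul +%R.
Proof.
case=> [k a] [l b] [n c]; rewrite /unitization_mul /=; congr pair.
  exact: mulrDr.
rewrite /= Zmod_actDr Zmod_actDl rngmulDr [X in X + _]addrACA.
exact: addrACA.
Qed.

HB.instance Definition _ := GRing.Zmodule_isPzRing.Build unitization
  unitization_mulA unitization_mul1u unitization_mulu1
  unitization_mulDl unitization_mulDr.

Lemma unitization_mulE x y a b :
  ((x, a) : unitization) * ((y, b) : unitization) =
    (x * y, Zmod_act y a + Zmod_act x b + a ** b).
Proof. by []. Qed.

Lemma unitization_1E : (1 : unitization) = (1, 0).
Proof. by []. Qed.

Definition unitization_emb (a : R) : unitization := (0, a).

End Unitization.

(** * Undirected graphs, with loops allowed *)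

Record graph := Graph {
  vertex : Type;
  edge : vertex -> vertex -> Prop;
  edge_sym : forall x y, edge x y -> edge y x
}.

Definition graph_isomorphism (G H : graph) (f : vertex G -> vertex H) : Prop :=
  bijective f /\ forall x y, edge x y <-> edge (f x) (f y).

(** * The compressed commuting graph *)

Section CompressedGraph.
Variable R : rngType.
Implicit Types a b : R.

Definition rngsim : rel R := fun a b => `[< rnggen a = rnggen b >].

Lemma rngsim_equiv : equiv_class_of rngsim.
Proof.
split=> [a|a b|b a c]; first exact/asboolP.
  by apply/asboolP/asboolP => ->.
by move=> /asboolP ab /asboolP bc; apply/asboolP; rewrite ab.
Qed.

Canonical rngsim_equiv_rel := EquivRelPack rngsim_equiv.

Definition rngclass a : {eq_quot rngsim} := \pi a.

(** Adjacency is independent of the representatives: see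
    [edge_compressed_graph]. *)
Definition rngclass_edge (x y : {eq_quot rngsim}) : Prop :=
  repr x ** repr y = repr y ** repr x.

Lemma rngclass_edge_sym x y : rngclass_edge x y -> rngclass_edge y x.
Proof. exact: esym. Qed.

Definition compressed_graph : graph := Graph rngclass_edge_sym.

Lemma edge_compressed_graph a b :
  @edge compressed_graph (rngclass a) (rngclass b) <-> a ** b = b ** a.
Proof.
have repr_class c : rnggen (repr (rngclass c)) = rnggen c.
  by apply/asboolP; rewrite -/(rngsim _ _) -eqmodE /= reprK.
by split; apply: rnggen_comm; rewrite repr_class.
Qed.

End CompressedGraph.

(** * The unital compressed commuting graph *)

Section UnitalCompressedGraph.
Variable R : pzRingType.
Implicit Types a b : R.

(** [(map_poly intr q).[a]] is not available here, since [{poly R}] requires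
    [1 != 0] in [R]. *)
Definition ringeval (q : {poly int}) a : R := \sum_(i < size q) a ^+ i *~ q`_i.

(** The subring [<a>_1] generated by [1] and [a]. *)
Definition ringgen a : set R := [set ringeval q a | q in [set: {poly int}]].

Lemma ringeval_comm q a b : a * b = b * a -> ringeval q a * b = b * ringeval q a.
Proof.
move=> ab; rewrite /ringeval mulr_suml mulr_sumr; apply: eq_bigr => i _.
by rewrite mulrzAl mulrzAr; congr (_ *~ _); apply/esym/commrX/esym.
Qed.

Lemma mem_ringgen a : ringgen a a.
Proof.
exists 'X => //.
by rewrite /ringeval size_polyX big_ord_recl big_ord1 !coefX /= mulr0z add0r.
Qed.

Lemma ringgen_comm a a' b b' : ringgen a = ringgen a' -> ringgen b = ringgen b' ->
  a * b = b * a -> a' * b' = b' * a'.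
Proof.
move=> ea eb ab.
have := mem_ringgen a'; rewrite -ea => -[q _ <-].
have := mem_ringgen b'; rewrite -eb => -[r _ <-].
by apply: ringeval_comm; apply/esym/ringeval_comm/esym.
Qed.

Definition ringsim : rel R := fun a b => `[< ringgen a = ringgen b >].

Lemma ringsim_equiv : equiv_class_of ringsim.
Proof.
split=> [a|a b|b a c]; first exact/asboolP.
  by apply/asboolP/asboolP => ->.
by move=> /asboolP ab /asboolP bc; apply/asboolP; rewrite ab.
Qed.

Canonical ringsim_equiv_rel := EquivRelPack ringsim_equiv.

Definition ringclass a : {eq_quot ringsim} := \pi a.

(** Adjacency is independent of the representatives: see
    [edge_unital_compressed_graph]. *)
Definition ringclass_edge (x y : {eq_quot ringsim}) : Prop :=
  repr x * repr y = repr y * repr x.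

Lemma ringclass_edge_sym x y : ringclass_edge x y -> ringclass_edge y x.
Proof. exact: esym. Qed.

Definition unital_compressed_graph : graph := Graph ringclass_edge_sym.

Lemma edge_unital_compressed_graph a b :
  @edge unital_compressed_graph (ringclass a) (ringclass b) <-> a * b = b * a.
Proof.
have repr_class c : ringgen (repr (ringclass c)) = ringgen c.
  by apply/asboolP; rewrite -/(ringsim _ _) -eqmodE /= reprK.
by split; apply: ringgen_comm; rewrite repr_class.
Qed.

End UnitalCompressedGraph.

(* Main.v *)
Require Import Defs.
From mathcomp Require Import all_boot all_order all_algebra.
From HB Require Import structures.
From mathcomp Require Import generic_quotient boolp classical_sets.

(** Evaluating an integer polynomial [q] at [i(a)] gives the pair formed by the
    class of [q(0)] and the value of [q - q(0)] at [a], hence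
    [<i(a)>_1 = Z_m x <a>].  So [<i(a)>_1] determines [<a>] and conversely.
    Every class of [R^1] is reached, because [(k, a)] and [(0, a)] differ by an
    integer multiple of [1] and thus generate the same unital subring. *)

Import GRing.Theory.
Local Open Scope ring_scope.
Local Open Scope classical_set_scope.
Local Open Scope quotient_scope.

Section UnitalSubring.
Variable R : pzRingType.
Implicit Types (u v w : R) (p q : {poly int}).

Lemma ringeval_widen q u n : (size q <= n)%N ->
  ringeval q u = \sum_(i < n) u ^+ i *~ q`_i.
Proof.
move=> le_qn; rewrite /ringeval (big_ord_widen n (fun i => u ^+ i *~ q`_i)) //.
rewrite big_mkcond; apply: eq_bigr => i _; case: ltnP => // le_qi.
by rewrite nth_default // mulr0z.
Qed.

Lemma ringevalD p q u : ringeval (p + q) u = ringeval p u + ringeval q u.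
Proof.
pose n := maxn (size p) (size q).
rewrite (@ringeval_widen (p + q) u n) ?size_polyD //.
rewrite (@ringeval_widen p u n) ?leq_maxl // (@ringeval_widen q u n) ?leq_maxr //.
by rewrite -big_split; apply: eq_bigr => i _; rewrite coefD mulrzDr.
Qed.

Lemma ringevalC (k : int) u : ringeval k%:P u = k%:~R.
Proof.
by rewrite (@ringeval_widen k%:P u 1) ?size_polyC_leq1 // big_ord1 coefC expr0.
Qed.

Lemma ringevalMX q u : ringeval (q * 'X) u = ringeval q u * u.
Proof.
rewrite (@ringeval_widen (q * 'X) u (size q).+1); last first.
  by apply: leq_trans (size_polyMleq _ _) _; rewrite size_polyX addn2.
rewrite big_ord_recl coefMX mulr0z add0r /ringeval mulr_suml.
by apply: eq_bigr => i _; rewrite coefMX /= exprSr mulrzAl.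
Qed.

Lemma ringevalZ (k : int) q u : ringeval (k *: q) u = ringeval q u *~ k.
Proof.
rewrite (@ringeval_widen (k *: q) u (size q)) ?size_scale_leq //.
rewrite /ringeval mulrz_suml; apply: eq_bigr => i _.
by rewrite coefZ mulrC mulrzA.
Qed.

Lemma ringgen_int (k : int) u : ringgen u k%:~R.
Proof. by exists k%:P => //; rewrite ringevalC. Qed.

Lemma ringgenD u v w : ringgen u v -> ringgen u w -> ringgen u (v + w).
Proof. by move=> [p _ <-] [q _ <-]; exists (p + q) => //; rewrite ringevalD. Qed.

Lemma ringgenM_self u v : ringgen u v -> ringgen u (v * u).
Proof. by move=> [p _ <-]; exists (p * 'X) => //; rewrite ringevalMX. Qed.

Lemma ringgenMz u v (k : int) : ringgen u v -> ringgen u (v *~ k).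
Proof. by move=> [p _ <-]; exists (k *: p) => //; rewrite ringevalZ. Qed.

Lemma sub_ringgen_addint u (k : int) : ringgen (u + k%:~R) `<=` ringgen u.
Proof.
move=> _ [q _ <-]; elim/poly_ind: q => [|q c IHq].
  by rewrite -[0 : {poly int}]polyC0 ringevalC; apply: ringgen_int.
rewrite ringevalD ringevalMX ringevalC mulrDr mulrzr.
apply: ringgenD (ringgen_int c u).
by apply: ringgenD; [apply: ringgenM_self|apply: ringgenMz].
Qed.

Lemma ringgen_addint u (k : int) : ringgen (u + k%:~R) = ringgen u.
Proof.
apply/seteqP; split; first exact: sub_ringgen_addint.
by have := @sub_ringgen_addint (u + k%:~R) (- k); rewrite mulrNz addrK.
Qed.

Lemma ringgen_repr u : ringgen (repr (ringclass u)) = ringgen u.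
Proof. by apply/asboolP; rewrite -/(ringsim _ _) -eqmodE /= reprK. Qed.

Lemma eq_ringclass u v : ringclass u = ringclass v <-> ringgen u = ringgen v.
Proof.
split=> euv; first by rewrite -ringgen_repr euv ringgen_repr.
by apply/eqP; rewrite eqmodE; apply/asboolP.
Qed.

End UnitalSubring.

Section Embedding.
Variable R : rngType.
Local Notation U := (unitization R).
Local Notation Zm := (Zmod (rngchar R)).
Implicit Types (a b : R) (q : {poly int}).

Lemma eq_rngclass a b : rnggen a = rnggen b -> rngclass a = rngclass b.
Proof. by move=> eab; apply/eqP; rewrite eqmodE; apply/asboolP. Qed.

Lemma rngeval_widen q a n : (size q <= n.+1)%N ->
  rngeval q a = \sum_(i < n) rngexp a i.+1 *~ q`_i.+1.
Proof.
move=> le_qn; rewrite /rngeval.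
rewrite -(big_mkord xpredT (fun i => rngexp a i.+1 *~ q`_i.+1)).
rewrite -(big_add1 _ _ 0%N n.+1 xpredT (fun i => rngexp a i *~ q`_i)).
rewrite [LHS](big_nat_widen _ _ n.+1) // [LHS]big_mkcond.
apply: eq_bigr => i _ /=; case: ltnP => // le_qi.
by rewrite nth_default // mulr0z.
Qed.

Lemma unitization_emb_is_zmod_morphism : zmod_morphism (@unitization_emb R).
Proof. by move=> a b; congr pair; rewrite /= subr0. Qed.

HB.instance Definition _ := GRing.isZmodMorphism.Build R U
  (@unitization_emb R) unitization_emb_is_zmod_morphism.

Lemma Zmod_act0 a : Zmod_act (0 : Zm) a = 0.
Proof. by apply: (addIr (Zmod_act 0 a)); rewrite -Zmod_actDl !add0r. Qed.

Lemma pi_Zmod0 : \pi_Zm 0 = 0.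
Proof. exact: pi_zeror. Qed.

Lemma pi_ZmodN (k : int) : \pi_Zm (- k) = - \pi_Zm k.
Proof. exact: pi_oppr. Qed.

Lemma unitization_embM a b :
  unitization_emb a * unitization_emb b = unitization_emb (a ** b).
Proof.
rewrite unitization_mulE mul0r; congr pair.
by rewrite /= !Zmod_act0 !add0r.
Qed.

Lemma unitization_embX a n :
  unitization_emb a ^+ n.+1 = unitization_emb (rngexp a n.+1).
Proof. by elim: n => // n IHn; rewrite exprS IHn unitization_embM. Qed.

Lemma intr_unitization (k : int) : k%:~R = (\pi_Zm k, 0) :> U.
Proof.
have nat_case n : n%:R = (\pi_Zm n%:Z, 0) :> U.
  elim: n => [|n IHn]; first by rewrite pi_Zmod0.
  by rewrite mulrS IHn intS pi_Zmod_add; congr pair; rewrite /= addr0.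
case: k => n; first exact: nat_case.
by rewrite NegzE mulrNz -pmulrn nat_case pi_ZmodN; congr pair; rewrite /= oppr0.
Qed.

Lemma ringeval_emb q a :
  ringeval q (unitization_emb a) = (\pi_Zm q`_0, rngeval q a).
Proof.
rewrite (@ringeval_widen _ q _ (size q).+1) // (@rngeval_widen q a (size q)) //.
rewrite big_ord_recl expr0 intr_unitization.
under eq_bigr => i _ do rewrite unitization_embX -raddfMz.
by rewrite -raddf_sum; congr pair; rewrite /= ?addr0 ?add0r.
Qed.

Lemma ringgen_emb a : ringgen (unitization_emb a) = [set u : U | rnggen a u.2].
Proof.
apply/seteqP; split=> [_ [q _ <-] | [k r] [q /= q0 <-]].
  rewrite ringeval_emb /=; exists (q - (q`_0)%:P).
    by rewrite /= hornerD hornerN hornerC horner_coef0 subrr.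
  rewrite (@rngeval_widen q a (size q)) // (@rngeval_widen _ a (size q)).
    by apply: eq_bigr => i _; rewrite coefB coefC subr0.
  apply: leq_trans (size_polyD _ _) _; rewrite geq_max leqnSn size_polyN.
  exact: leq_trans (size_polyC_leq1 _) _.
exists (q + (repr k)%:P) => //; rewrite ringeval_emb; congr pair.
  by rewrite coefD coefC -horner_coef0 q0 add0r reprK.
rewrite (@rngeval_widen q a (size q)) // (@rngeval_widen _ a (size q)).
  by apply: eq_bigr => i _; rewrite coefD coefC addr0.
apply: leq_trans (size_polyD _ _) _; rewrite geq_max leqnSn.
exact: leq_trans (size_polyC_leq1 _) _.
Qed.

Lemma eq_ringgen_emb a b :
  ringgen (unitization_emb a) = ringgen (unitization_emb b) <->
  rnggen a = rnggen b.
Proof.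
split=> [|eab]; last by rewrite !ringgen_emb eab.
rewrite !ringgen_emb; exact: (congr1 (fun A : set U => [set r | A (0, r)])).
Qed.

Lemma ringgen_unitization (u : U) : ringgen u = ringgen (unitization_emb u.2).
Proof.
case: u => k a; rewrite -(@ringgen_addint _ (unitization_emb a) (repr k)).
rewrite intr_unitization reprK; congr ringgen; congr pair.
  by rewrite /= add0r.
by rewrite /= addr0.
Qed.

Lemma unitization_emb_comm a b : a ** b = b ** a <->
  unitization_emb a * unitization_emb b = unitization_emb b * unitization_emb a.
Proof. by rewrite !unitization_embM; split=> [->|[]]. Qed.

End Embedding.

Theorem proposition6 (R : rngType) :
  exists f : vertex (compressed_graph R) ->
             vertex (unital_compressed_graph (unitization R)),
    graph_isomorphism f /\
    forall a : R, f (rngclass a) = ringclass (unitization_emb a).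
Proof.
pose f (x : vertex (compressed_graph R)) :
    vertex (unital_compressed_graph (unitization R)) :=
  ringclass (unitization_emb (repr x)).
have f_class a : f (rngclass a) = ringclass (unitization_emb a).
  apply/eq_ringclass/eq_ringgen_emb.
  by apply/asboolP; rewrite -/(rngsim _ _) -eqmodE /= reprK.
exists f; split=> //; split.
  exists (fun y => rngclass (repr y).2) => [x | y].
    rewrite -[RHS]reprK; apply/eq_rngclass/eq_ringgen_emb.
    by rewrite -ringgen_unitization ringgen_repr.
  rewrite f_class -[RHS]reprK; apply/(@eq_ringclass (unitization R)).
  by rewrite -ringgen_unitization.
move=> x y; rewrite -[x]reprK -[y]reprK !f_class.
by rewrite edge_compressed_graph edge_unital_compressed_graph unitization_emb_comm.
Qed.
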